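(* Let $K_{1,3}$ be the claw graph (one vertex adjacent to three pairwise non-adjacent vertices) and $K_4\setminus e$ the diamond graph ($K_4$ with one edge removed). Then $W[K_{1,3}]=W^*[K_{1,3}]=E[K_{1,3}]=4$ and $W[K_4\setminus e]=W^*[K_4\setminus e]=E[K_4\setminus e]=4$.
   Context: Graphs are finite, simple, undirected, loopless. First-order sentences about graphs use only adjacency $\sim$ and equality $=$. Write $F\sqsubset G$ if $G$ contains an induced copy of $F$. $W[F]$ is the minimum number of distinct variables in a first-order sentence $\Phi$ with $G\models\Phi$ iff $F\sqsubset G$ for all graphs $G$. For non-isomorphic $G,H$, $W(G,H)$ is the minimum number of distinct variables in a sentence true on one and false on the other; $W^*[F]=\max\{W(G,H):F\sqsubset G,\ F\not\sqsubset H\}$. For $k\ge2$, $\mathrm{EA}_k$ says: for all disjoint vertex sets $X,Y$ with $|X\cup Y|<k$ there is $z\notin X\cup Y$ adjacent to all of $X$ and to none of $Y$; $\mathrm{EA}_1$ says the graph is non-empty. The extension index $E[F]$ is the minimum $k$ such that every graph satisfying $\mathrm{EA}_k$ contains an induced copy of $F$. *)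

(* Defs.v *)
From mathcomp Require Import all_boot.

Set Implicit Arguments.
Unset Strict Implicit.
Unset Printing Implicit Defensive.

(* The vertex set may be empty. *)
Record graph := Graph {
  vertex :> finType;
  adj : rel vertex;
  adj_sym : symmetric adj;
  adj_irrefl : irreflexive adj
}.

Definition induced_in (F G : graph) : Prop :=
  exists f : F -> G,
    injective f /\ forall x y : F, adj (f x) (f y) = adj x y.

Notation "F ⊏ G" := (induced_in F G) (at level 70, no associativity).

Inductive formula : Type :=
| FAdj of nat & nat
| FEq of nat & nat
| FNot of formula
| FAnd of formula & formula
| FOr of formula & formula
| FEx of nat & formula
| FAll of nat & formula.

Fixpoint vars (p : formula) : seq nat :=
  match p with
  | FAdj x y | FEq x y => [:: x; y]
  | FNot q => vars q
  | FAnd q r | FOr q r => vars q ++ vars r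
  | FEx x q | FAll x q => x :: vars q
  end.

Fixpoint free_vars (p : formula) : seq nat :=
  match p with
  | FAdj x y | FEq x y => [:: x; y]
  | FNot q => free_vars q
  | FAnd q r | FOr q r => free_vars q ++ free_vars r
  | FEx x q | FAll x q => [seq y <- free_vars q | y != x]
  end.

Definition sentence (p : formula) : Prop := free_vars p = [::].

(* Variables may be re-quantified; each counts once. *)
Definition nvars (p : formula) : nat := size (undup (vars p)).

Definition upd (T : Type) (e : nat -> option T) (x : nat) (v : T) :
    nat -> option T :=
  fun y => if y == x then Some v else e y.

(* Assignments are partial, since the empty graph has no total assignment.
   The value chosen for atoms with an unassigned variable is irrelevant for
   sentences. *)
Fixpoint sat (G : graph) (e : nat -> option G) (p : formula) : bool :=
  match p with
  | FAdj x y => if (e x, e y) is (Some a, Some b) then adj a b else false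
  | FEq x y => if (e x, e y) is (Some a, Some b) then a == b else false
  | FNot q => ~~ sat e q
  | FAnd q r => sat e q && sat e r
  | FOr q r => sat e q || sat e r
  | FEx x q => [exists v : G, sat (upd e x v) q]
  | FAll x q => [forall v : G, sat (upd e x v) q]
  end.

Definition models (G : graph) (p : formula) : bool :=
  sat (fun _ : nat => None : option G) p.

Notation "G ⊨ p" := (models G p) (at level 70, no associativity).

Definition is_min (P : nat -> Prop) (n : nat) : Prop :=
  P n /\ forall m, P m -> n <= m.

Definition is_max (P : nat -> Prop) (n : nat) : Prop :=
  P n /\ forall m, P m -> m <= n.

(* W[F] = k *)
Definition W_is (F : graph) (k : nat) : Prop :=
  is_min (fun n => exists p : formula,
            [/\ sentence p, nvars p = n
              & forall G : graph, G ⊨ p <-> F ⊏ G]) k.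

(* W(G, H) = k; no k qualifies when G and H are isomorphic. *)
Definition Wpair_is (G H : graph) (k : nat) : Prop :=
  is_min (fun n => exists p : formula,
            [/\ sentence p, nvars p = n
              & (G ⊨ p /\ ~ H ⊨ p) \/ (H ⊨ p /\ ~ G ⊨ p)]) k.

(* W^*[F] = k *)
Definition Wstar_is (F : graph) (k : nat) : Prop :=
  is_max (fun n => exists G H : graph,
            [/\ F ⊏ G, ~ F ⊏ H & Wpair_is G H n]) k.

(* For k = 1 the sets X and Y are empty, so EA 1 G says that G is non-empty. *)
Definition EA (k : nat) (G : graph) : Prop :=
  forall X Y : {set G}, [disjoint X & Y] -> #|X :|: Y| < k ->
    exists z : G,
      [/\ z \notin X :|: Y,
          forall x, x \in X -> adj z x
        & forall y, y \in Y -> ~~ adj z y].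

(* E[F] = k; EA k is only considered for k >= 1. *)
Definition E_is (F : graph) (k : nat) : Prop :=
  is_min (fun n => 1 <= n /\ forall G : graph, EA n G -> F ⊏ G) k.

Definition claw_adj : rel 'I_4 :=
  fun i j => (i != j) && ((i == ord0) || (j == ord0)).

Lemma claw_adj_sym : symmetric claw_adj.
Proof. by move=> i j; rewrite /claw_adj eq_sym orbC. Qed.

Lemma claw_adj_irrefl : irreflexive claw_adj.
Proof. by move=> i; rewrite /claw_adj eqxx. Qed.

Definition claw : graph := Graph claw_adj_sym claw_adj_irrefl.

(* The removed edge joins 0 and 1. *)
Definition diamond_adj : rel 'I_4 :=
  fun i j => (i != j) && ~~ ((i < 2) && (j < 2)).

Lemma diamond_adj_sym : symmetric diamond_adj.
Proof. by move=> i j; rewrite /diamond_adj eq_sym [(i < 2) && _]andbC. Qed.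

Lemma diamond_adj_irrefl : irreflexive diamond_adj.
Proof. by move=> i; rewrite /diamond_adj eqxx. Qed.

Definition diamond : graph := Graph diamond_adj_sym diamond_adj_irrefl.

(* Main.v *)
(** Any two graphs satisfying EA_k agree on all sentences with at most k
    variables, since EA_k lets Duplicator answer every move of the k-pebble
    game.  So if EA_k holds in a graph G that contains F and in a graph H that
    does not, then no sentence with k variables separates G from H, so W[F],
    W*[F] and E[F] all exceed k.  When F has k+1 vertices these bounds are
    tight: F is described by its diagram, and EA_(k+1) lets one embed F vertex
    by vertex.  For both the claw and the diamond, k = 3, H is the 3x3 rook's
    graph (the Paley graph of order 9) and G is the Paley graph of order 13. *)

Require Import Defs.
From mathcomp Require Import all_boot.

Set Implicit Arguments.
Unset Strict Implicit.
Unset Printing Implicit Defensive.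

(** * Extension axioms and vertex-by-vertex embedding *)

Lemma EA_leq (m n : nat) (G : graph) : m <= n -> EA n G -> EA m G.
Proof. by move=> le_mn eaG X Y dXY ltm; apply: eaG => //; apply: leq_trans le_mn. Qed.

Lemma EA_inhabited (k : nat) (G : graph) : 0 < k -> EA k G -> inhabited G.
Proof.
move=> k_gt0 /(_ set0 set0) []; rewrite ?setU0 ?cards0 //.
by rewrite -setI_eq0 set0I.
Qed.

(** Working form of [EA]: the vertices form a list, repetitions allowed, and a predicate prescribes
    the adjacencies, so later proofs build no disjoint sets. *)
Lemma EA_seq (k : nat) (G : graph) (s : seq G) (c : pred G) :
    EA k G -> size s < k ->
  exists2 z, z \notin s & {in s, forall x, adj z x = c x}.
Proof.
move=> eaG lt_sk.
have [||z [zN zX zY]] := eaG [set x in s | c x] [set x in s | ~~ c x].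
- rewrite -setI_eq0; apply/eqP/setP => x; rewrite !inE.
  by case: (c x); rewrite ?andbF.
- apply: leq_ltn_trans lt_sk; apply: leq_trans (card_size s).
  apply/subset_leq_card/subsetP => x.
  by rewrite !inE => /orP[] /andP[].
exists z => [|x sx].
  by apply: contra zN => sz; rewrite !inE sz; case: (c z).
case cx: (c x); first by apply: zX; rewrite inE sx.
by apply/negbTE/zY; rewrite inE sx cx.
Qed.

Lemma EA_induced (F G : graph) (k : nat) :
  0 < k -> #|F| <= k -> EA k G -> F ⊏ G.
Proof.
move=> k_gt0 le_Fk eaG.
have [z0] := EA_inhabited k_gt0 eaG.
(* Relativizing both conditions to a list of vertices permits induction on it; each new vertex then
   faces fewer than [k] earlier images. *)
suff [f [f_inj f_adj]] : exists f : F -> G, {in enum F &, injective f} /\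
    {in enum F &, forall x y, adj (f x) (f y) = adj x y}.
  by exists f; split=> x y; [apply: f_inj | apply: f_adj]; rewrite mem_enum.
move: le_Fk (enum_uniq F); rewrite cardE.
elim: (enum F) => [|x s IHs] /=; first by exists (fun=> z0).
move=> lt_sk /andP[xNs s_uniq].
have [f [f_inj f_adj]] := IHs (ltnW lt_sk) s_uniq.
(* [c] transports the neighbourhood of [x] along [f]; injectivity of [f] on [s] makes it
   faithful. *)
pose c a := [exists y : F, [&& y \in s, f y == a & adj x y]].
have [|z zN zc] := @EA_seq k G (map f s) c eaG; first by rewrite size_map.
have zf y : y \in s -> adj z (f y) = adj x y.
  move=> sy; rewrite zc ?map_f //; apply/existsP/idP => [[y']|xy].
    by case/and3P=> sy' /eqP /f_inj -> .
  by exists y; rewrite sy eqxx.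
have neq y : y \in s -> (y == x) = false.
  by move=> sy; apply: contraNF xNs => /eqP <-.
exists (fun y => if y == x then z else f y); split=> y y';
  rewrite !inE => /predU1P[->|sy] /predU1P[->|sy']; rewrite ?eqxx ?neq //.
- by move=> zE; case/negP: zN; rewrite zE map_f.
- by move=> zE; case/negP: zN; rewrite -zE map_f.
- exact: f_inj.
- by rewrite !adj_irrefl.
- exact: zf.
- by rewrite adj_sym zf // adj_sym.
- exact: f_adj.
Qed.

(** * The pebble game *)

(** A position of the game: each variable in [V] is a pair of pebbles, off the board when its value
    is [None]. Comparing atoms through [sat] makes the atomic cases of [partial_iso_sat]
    immediate. *)
Definition partial_iso (G H : graph) (V : seq nat)
    (e : nat -> option G) (e' : nat -> option H) : Prop :=
  {in V &, forall x y,
    [/\ isSome (e x) = isSome (e' x),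
        sat e (FEq x y) = sat e' (FEq x y)
      & sat e (FAdj x y) = sat e' (FAdj x y)]}.

Lemma partial_iso_sym (G H : graph) V (e : nat -> option G) (e' : nat -> option H) :
  partial_iso V e e' -> partial_iso V e' e.
Proof. by move=> iso x y Vx Vy; case: (iso x y Vx Vy). Qed.

(** Duplicator's answer when Spoiler moves pebble [x] to [v]. If another pebble already lies on [v],
    its partner marks the answer; otherwise [EA] supplies a fresh vertex with the right adjacencies
    to the other pebbles. *)
Lemma partial_iso_extend (G H : graph) (k : nat) (V : seq nat)
    (e : nat -> option G) (e' : nat -> option H) (x : nat) (v : G) :
    EA k H -> size V <= k -> x \in V -> partial_iso V e e' ->
  exists w : H, partial_iso V (upd e x v) (upd e' x w).
Proof.
move=> eaH le_Vk Vx iso.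
pose V' := [seq y <- V | y != x].
have memV' y : y \in V -> y != x -> y \in V'.
  by rewrite mem_filter => -> ->.
have subV' y : y \in V' -> y \in V by rewrite mem_filter => /andP[].
have isoE y : y \in V' -> (exists a b, e y = Some a /\ e' y = Some b)
    \/ (e y = None /\ e' y = None).
  move=> /subV' Vy; have [+ _ _] := iso y y Vy Vy.
  by case: (e y) (e' y) => [a|] [b|] //= _; [left; exists a, b | right].
suff [w wP] : exists w : H, forall y a b, y \in V' -> e y = Some a -> e' y = Some b ->
    (v == a) = (w == b) /\ adj v a = adj w b.
  exists w => y y' Vy Vy'; have [+ + +] := iso y y' Vy Vy'.
  rewrite /= /upd; case: (eqVneq y x) => [->|yx]; case: (eqVneq y' x) => [->|y'x] //=.
  - by rewrite !eqxx !adj_irrefl.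
  - move=> _ _ _.
    case: (isoE y' (memV' _ Vy' y'x)) => [[a [b [ea eb]]]|[-> ->]] //.
    by rewrite ea eb; have [-> ->] := wP _ _ _ (memV' _ Vy' y'x) ea eb.
  - move=> _ _ _.
    case: (isoE y (memV' _ Vy yx)) => [[a [b [ea eb]]]|[-> ->]] //.
    rewrite ea eb eq_sym [b == w]eq_sym adj_sym [adj b w]adj_sym.
    by have [-> ->] := wP _ _ _ (memV' _ Vy yx) ea eb.
case: (boolP (has (fun y => e y == Some v) V')) => [/hasP[y V'y /eqP ey]|].
  case: (isoE y V'y) => [[_ [b [_ eb]]]|[]]; last by rewrite ey.
  exists b => y' a' b' V'y' ea' eb'.
  have [_] := iso y y' (subV' _ V'y) (subV' _ V'y').
  by rewrite /= ey eb ea' eb'.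
move=> /hasPn vN.
pose c b := has (fun y => (e' y == Some b) &&
                          (if e y is Some a then adj v a else false)) V'.
have [|w wN wc] := @EA_seq k H (pmap e' V') c eaH.
  (* Since [x] is in [V], lifting pebble [x] leaves fewer than [k] others. *)
  rewrite size_pmap; apply: leq_ltn_trans (count_size _ _) _.
  apply: leq_trans le_Vk; rewrite size_filter -(count_predC (pred1 x) V).
  by rewrite -[X in X < _]add0n ltn_add2r -has_count has_pred1.
exists w => y a b V'y ea eb.
have memb : b \in pmap e' V' by rewrite mem_pmap; apply/mapP; exists y.
split.
  have := vN y V'y; rewrite ea => va.
  have -> : (v == a) = false.
    by apply: contraNF va => /eqP ->.
  by apply/esym; apply: contraNF wN => /eqP ->.
rewrite wc //; apply/idP/hasP => [va|[y' V'y' /andP[/eqP eb']]].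
  by exists y => //; rewrite eb eqxx ea.
case: (isoE y' V'y') => [[a' [b'' [ea' eb'']]]|[_]]; last by rewrite eb'.
rewrite ea'.
(* The pebble on [b] that [c] consults does not matter: pebbles sharing a vertex of [H] share one of
   [G]. *)
have [_ + _] := iso y y' (subV' _ V'y) (subV' _ V'y').
by rewrite /= ea ea' eb eb' eqxx => /eqP ->.
Qed.

(** A quantifier over [x] moves pebble [x]. Spoiler may play in either graph, so Duplicator answers
    by [EA] on both sides. *)
Lemma partial_iso_sat (G H : graph) (k : nat) (V : seq nat) (p : formula)
    (e : nat -> option G) (e' : nat -> option H) :
    EA k G -> EA k H -> size V <= k -> {subset vars p <= V} ->
  partial_iso V e e' -> sat e p = sat e' p.
Proof.
move=> eaG eaH le_Vk.
elim: p e e' => [x y|x y|q IHq|q IHq r IHr|q IHq r IHr|x q IHq|x q IHq] e e' /= sV iso.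
- by have [||] := iso x y; rewrite ?sV ?inE ?eqxx ?orbT.
- by have [||] := iso x y; rewrite ?sV ?inE ?eqxx ?orbT.
- by rewrite (IHq e e').
- by rewrite (IHq e e') ?(IHr e e') // => x xV; apply: sV; rewrite mem_cat xV ?orbT.
- by rewrite (IHq e e') ?(IHr e e') // => x xV; apply: sV; rewrite mem_cat xV ?orbT.
- have Vx : x \in V by rewrite sV ?mem_head.
  have sqV : {subset vars q <= V} by move=> y yq; rewrite sV ?inE ?yq ?orbT.
  apply/existsP/existsP => [[v satv]|[w satw]].
    have [w iso'] := partial_iso_extend v eaH le_Vk Vx iso.
    by exists w; rewrite -(IHq _ _ sqV iso').
  have [v /partial_iso_sym iso'] :=
    partial_iso_extend w eaG le_Vk Vx (partial_iso_sym iso).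
  by exists v; rewrite (IHq _ _ sqV iso').
- have Vx : x \in V by rewrite sV ?mem_head.
  have sqV : {subset vars q <= V} by move=> y yq; rewrite sV ?inE ?yq ?orbT.
  apply/forallP/forallP => [sat_all w|sat_all v].
    have [v /partial_iso_sym iso'] :=
      partial_iso_extend w eaG le_Vk Vx (partial_iso_sym iso).
    by rewrite -(IHq _ _ sqV iso').
  have [w iso'] := partial_iso_extend v eaH le_Vk Vx iso.
  by rewrite (IHq _ _ sqV iso').
Qed.

Lemma EA_models (G H : graph) (k : nat) (p : formula) :
  EA k G -> EA k H -> nvars p <= k -> (G ⊨ p) = (H ⊨ p).
Proof.
(* The pebbles are the variables of [p], and none is on the board at the start. *)
move=> eaG eaH le_pk; apply: (partial_iso_sat eaG eaH le_pk) => // x.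
by rewrite mem_undup.
Qed.

(** * The existential sentence describing an induced subgraph *)

Definition FExs (s : seq nat) (q : formula) : formula := foldr FEx q s.

Lemma vars_FExs s q : vars (FExs s q) = s ++ vars q.
Proof. by elim: s => //= x s ->. Qed.

Lemma free_vars_FExs s q :
  free_vars (FExs s q) = [seq x <- free_vars q | x \notin s].
Proof.
elim: s => [|x s IHs] /=; first by rewrite filter_predT.
by rewrite IHs -filter_predI; apply: eq_filter => y /=; rewrite inE negb_or.
Qed.

Lemma free_vars_sub p : {subset free_vars p <= vars p}.
Proof.
elim: p => [x y|x y|q IHq|q IHq r IHr|q IHq r IHr|x q IHq|x q IHq] z //=.
- exact: IHq.
- by rewrite !mem_cat => /orP[/IHq->|/IHr->]; rewrite ?orbT.
- by rewrite !mem_cat => /orP[/IHq->|/IHr->]; rewrite ?orbT.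
- by rewrite mem_filter inE => /andP[_ /IHq->]; rewrite orbT.
- by rewrite mem_filter inE => /andP[_ /IHq->]; rewrite orbT.
Qed.

Lemma eq_sat (G : graph) (p : formula) (e1 e2 : nat -> option G) :
  e1 =1 e2 -> sat e1 p = sat e2 p.
Proof.
elim: p e1 e2 => [x y|x y|q IHq|q IHq r IHr|q IHq r IHr|x q IHq|x q IHq] e1 e2 e12 /=.
- by rewrite !e12.
- by rewrite !e12.
- by rewrite (IHq _ e2).
- by rewrite (IHq _ e2) ?(IHr _ e2).
- by rewrite (IHq _ e2) ?(IHr _ e2).
- by apply: eq_existsb => v; apply: IHq => y; rewrite /upd e12.
- by apply: eq_forallb => v; apply: IHq => y; rewrite /upd e12.
Qed.

Lemma sat_FExs (G : graph) s q (e : nat -> option G) :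
  sat e (FExs s q) <->
  exists g : nat -> option G,
    [/\ {in s, forall x, isSome (g x)}, forall x, x \notin s -> g x = e x & sat g q].
Proof.
elim: s e => [|x s IHs] e /=.
  split=> [sq|[g [_ ge]]]; first by exists e.
  by rewrite (eq_sat q (e2 := e)) // => y; apply: ge.
split=> [/existsP[v /IHs[g [gs ge gq]]]|[g [gs ge gq]]].
  exists g; split=> // y; rewrite inE.
    case/predU1P=> [->|/gs //]; case: (boolP (x \in s)) => [/gs //|xs].
    by rewrite ge // /upd eqxx.
  by rewrite negb_or => /andP[yx ys]; rewrite ge // /upd (negbTE yx).
have := gs x (mem_head _ _); case gx: (g x) => [v|] // _.
apply/existsP; exists v; apply/IHs; exists g; split=> // y ys.
  by apply: gs; rewrite inE ys orbT.
rewrite /upd; case: eqVneq => [-> //|yx].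
by rewrite ge // inE negb_or yx.
Qed.

Section Diagram.

Variable F : graph.

Definition vertex_var (x : F) : nat := enum_rank x.

Definition pair_literals (x y : F) : formula :=
  if x == y then FEq (vertex_var x) (vertex_var y)
  else FAnd (FNot (FEq (vertex_var x) (vertex_var y)))
    (if adj x y then FAdj (vertex_var x) (vertex_var y)
     else FNot (FAdj (vertex_var x) (vertex_var y))).

(* [FEq 0 0] stands for truth; it holds because variable 0 is quantified, as
   long as [F] is non-empty. *)
Definition diagram : formula :=
  foldr (fun xy => FAnd (pair_literals xy.1 xy.2)) (FEq 0 0) (enum {: F * F}).

Definition contains : formula := FExs (iota 0 #|F|) diagram.

Hypothesis F_gt0 : 0 < #|F|.

Lemma vars_diagram : {subset vars diagram <= iota 0 #|F|}.
Proof.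
have lt_var x : vertex_var x \in iota 0 #|F| by rewrite mem_iota ltn_ord.
have sub x y : {subset vars (pair_literals x y) <= iota 0 #|F|}.
  move=> z; rewrite /pair_literals.
  by case: ifP => _; last case: ifP => _;
     rewrite /= !inE; do ?[case/orP]; move=> /eqP ->.
rewrite /diagram; elim: (enum _) => [|[x y] s IHs] z /=.
  by rewrite !inE orbb => /eqP->; rewrite mem_iota.
by rewrite mem_cat => /orP[/sub|/IHs].
Qed.

Lemma sentence_contains : sentence contains.
Proof.
rewrite /sentence free_vars_FExs; apply/eqP; rewrite -[_ == _]negbK -has_filter.
by apply/hasPn => x /free_vars_sub/vars_diagram ->.
Qed.

Lemma nvars_contains : nvars contains = #|F|.
Proof.
rewrite /nvars -[RHS](size_iota 0); apply/perm_size/uniq_perm.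
- exact: undup_uniq.
- exact: iota_uniq.
move=> x; rewrite mem_undup vars_FExs mem_cat.
by case: (boolP (x \in vars _)) => [/vars_diagram ->|]; rewrite ?orbF.
Qed.

Lemma sat_diagram (G : graph) (e : nat -> option G) :
  sat e diagram = isSome (e 0) &&
    [forall xy : F * F, sat e (pair_literals xy.1 xy.2)].
Proof.
have -> : [forall xy : F * F, sat e (pair_literals xy.1 xy.2)] =
    all (fun xy => sat e (pair_literals xy.1 xy.2)) (enum {: F * F}).
  by apply/forallP/allP => lit xy => [_|]; apply: lit; rewrite ?mem_enum.
rewrite /diagram; elim: (enum _) => [|xy s IHs] /=.
  by case: (e 0) => //= a; rewrite eqxx.
by rewrite IHs andbCA.
Qed.

Lemma models_contains (G : graph) : G ⊨ contains <-> F ⊏ G.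
Proof.
split=> [/sat_FExs[g [gs _]]|[f [f_inj f_adj]]].
  rewrite sat_diagram => /andP[_ /forallP g_lit].
  have gE x : exists a, g (vertex_var x) == Some a.
    have := gs (vertex_var x); rewrite mem_iota ltn_ord => /(_ isT).
    by case: (g _) => // a _; exists a.
  pose f x := xchoose (gE x); have fE x : g (vertex_var x) = Some (f x).
    exact/eqP/(xchooseP (gE x)).
  have f_lit x y : sat g (pair_literals x y) by exact: (g_lit (x, y)).
  have f_inj : injective f.
    move=> x y fxy; apply/eqP; move: (f_lit x y); rewrite /pair_literals.
    by case: eqVneq => //= _; rewrite !fE fxy eqxx.
  exists f; split=> // x y; move: (f_lit x y); rewrite /pair_literals.
  case: eqVneq => [-> _|_ /= /andP[_]]; first by rewrite !adj_irrefl.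
  by case: (adj x y) => /=; rewrite !fE => // /negbTE.
apply/sat_FExs.
(* [insub] makes [g] undefined from [#|F|] on, where [sat_FExs] asks for agreement with the empty
   assignment. *)
pose g n := omap (fun i : 'I_#|F| => f (enum_val i)) (insub n).
have gE x : g (vertex_var x) = Some (f x).
  by rewrite /g valK /= enum_rankK.
exists g; split=> [n|n|].
- by rewrite mem_iota /g => lt_nF; rewrite insubT.
- by rewrite mem_iota /g => ge_nF; rewrite insubF //; apply: negbTE.
rewrite sat_diagram {1}/g insubT /=; apply/forallP => -[x y].
rewrite /pair_literals /=; case: eqVneq => [->|xy] /=; first by rewrite !gE eqxx.
rewrite !gE inj_eq // xy /=.
by case axy: (adj x y); rewrite /= !gE f_adj axy.
Qed.

End Diagram.

(** * From a pair of witness graphs to the three indices *)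

Lemma indices_of_witnesses (F G H : graph) (k : nat) :
    #|F| = k.+1 -> EA k G -> EA k H -> F ⊏ G -> ~ F ⊏ H ->
  [/\ W_is F k.+1, Wstar_is F k.+1 & E_is F k.+1].
Proof.
move=> cardF eaG eaH FG FH.
have F_gt0 : 0 < #|F| by rewrite cardF.
(* [contains F] separates every admissible pair, so no W(A, B) exceeds [k.+1]. *)
have sepF (A B : graph) : F ⊏ A -> ~ F ⊏ B ->
    exists p, [/\ sentence p, nvars p = k.+1 &
      (A ⊨ p /\ ~ B ⊨ p) \/ (B ⊨ p /\ ~ A ⊨ p)].
  move=> FA FB; exists (contains F); split.
  - exact: sentence_contains.
  - by rewrite nvars_contains.
  by left; split=> [|/(models_contains F_gt0)]; first exact/models_contains.
split; split.
- exists (contains F); split; first exact: sentence_contains.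
    by rewrite nvars_contains.
  by move=> A; apply: models_contains.
- move=> m [p [_ <- pF]]; rewrite ltnNge; apply/negP => /(EA_models eaG eaH) GH.
  by apply/FH/pF; rewrite -GH; apply/pF.
- exists G, H; split=> //; split; first exact: sepF.
  move=> m [p [_ <- sep]]; rewrite ltnNge; apply/negP => /(EA_models eaG eaH) GH.
  by case: sep; rewrite GH => -[].
- by move=> m [A [B [FA FB [_]]]]; apply; apply: sepF.
- by split=> // A; apply: EA_induced; rewrite ?cardF.
- move=> m [_ mF]; rewrite ltnNge; apply/negP => le_mk.
  exact/FH/mF/(EA_leq le_mk).
Qed.

(** * The Paley graphs of order 9 and 13 *)

(* The adjacency is given on [nat] so that statements about all vertices can be
   decided by evaluation over [iota 0 n]. *)
Section OrdGraph.

Variables (n : nat) (r : rel nat).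

Definition nat_adj : rel nat := fun i j => (i != j) && (r i j || r j i).

Definition ord_adj : rel 'I_n := fun i j => nat_adj i j.

Lemma ord_adj_sym : symmetric ord_adj.
Proof. by move=> i j; rewrite /ord_adj /nat_adj eq_sym orbC. Qed.

Lemma ord_adj_irrefl : irreflexive ord_adj.
Proof. by move=> i; rewrite /ord_adj /nat_adj eqxx. Qed.

Definition ord_graph : graph := Graph ord_adj_sym ord_adj_irrefl.

Definition all_below (P : pred nat) : bool := all P (iota 0 n).

Lemma all_belowP (P : pred nat) : all_below P -> forall i : 'I_n, P i.
Proof. by move=> /allP allP i; apply: allP; rewrite mem_iota ltn_ord. Qed.

Definition has_extension (i j : nat) (b c : bool) : bool :=
  has (fun k => [&& k != i, k != j, nat_adj k i == b & nat_adj k j == c]) (iota 0 n).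

(** Fewer than three vertices always fit into a pair [i], [j], possibly with [i == j]; the test
    excuses only contradictory demands on a repeated vertex. *)
Lemma EA3_ord_graph :
    0 < n ->
    all_below (fun i => all_below (fun j =>
      all (fun b => all (fun c => (i == j) && (b != c) || has_extension i j b c)
        [:: true; false]) [:: true; false])) ->
  EA 3 ord_graph.
Proof.
move=> n_gt0 ext X Y dXY ltXY.
have [x [y subXY]] : exists x y : 'I_n, X :|: Y \subset [set x; y].
  pose x0 := Ordinal n_gt0; move: (X :|: Y) ltXY => Z ltZ.
  (* The default [x0] pads the set when it has fewer than two elements. *)
  exists (nth x0 (enum Z) 0), (nth x0 (enum Z) 1).
  apply/subsetP => z; rewrite -mem_enum !inE; move: ltZ; rewrite cardE.
  by case: (enum Z) => [|a [|b []]] //= _; rewrite !inE // => ->.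
(* The demands are membership in [X]; a padding vertex outside [X] and [Y] is merely asked to be a
   non-neighbour. *)
have /hasP[k] : has_extension x y (x \in X) (y \in X).
  have boolIn (b : bool) : b \in [:: true; false] by case: b.
  have := all_belowP (all_belowP ext x) y.
  move=> /allP/(_ _ (boolIn (x \in X)))/allP/(_ _ (boolIn (y \in X))).
  have /negbTE -> // : ~~ ((x == y :> nat) && ((x \in X) != (y \in X))).
  by apply/andP => -[/eqP/val_inj ->]; rewrite eqxx.
rewrite mem_iota => /= lt_kn /and4P[kx ky /eqP akx /eqP aky].
have inXY z : z \in X :|: Y -> z = x \/ z = y.
  by move/(subsetP subXY); rewrite !inE => /orP[]/eqP; [left | right].
have XN z : z \in Y -> (z \in X) = false by apply: disjointFl.
exists (Ordinal lt_kn); split.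
- by apply/negP => /inXY[] E; move: kx ky; rewrite -E /= eqxx.
- move=> z Xz; rewrite /= /ord_adj.
  have /inXY[zE|zE] : z \in X :|: Y by rewrite inE Xz.
    by rewrite zE akx -zE.
  by rewrite zE aky -zE.
- move=> z Yz; rewrite /= /ord_adj.
  have /inXY[zE|zE] : z \in X :|: Y by rewrite inE Yz orbT.
    by rewrite zE akx -zE XN.
  by rewrite zE aky -zE XN.
Qed.

End OrdGraph.

(** Vertex [i] is the cell in row [i %/ 3] and column [i %% 3] of a 3x3 board. *)
Definition same_line (i j : nat) : bool :=
  (i %/ 3 == j %/ 3) || (i %% 3 == j %% 3).

Definition paley9 : graph := ord_graph 9 same_line.

(* The non-zero squares modulo 13.  Since [-1] is one of them, truncated
   subtraction is harmless: [nat_adj] symmetrizes the relation. *)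
Definition square_diff (i j : nat) : bool := i - j \in [:: 1; 3; 4; 9; 10; 12].

Definition paley13 : graph := ord_graph 13 square_diff.

Lemma EA3_paley9 : EA 3 paley9.
Proof. by apply: EA3_ord_graph => //; vm_compute. Qed.

Lemma EA3_paley13 : EA 3 paley13.
Proof. by apply: EA3_ord_graph => //; vm_compute. Qed.

Definition paley13_map (s : seq nat) (i : 'I_4) : paley13 := inord (nth 0 s i).

Lemma induced_paley13 (a : rel 'I_4) (sa : symmetric a) (ia : irreflexive a)
    (s : seq nat) :
    size s = 4 -> uniq s -> all (fun i => i < 13) s ->
    (forall i j, a i j = nat_adj square_diff (nth 0 s i) (nth 0 s j)) ->
  Graph sa ia ⊏ paley13.
Proof.
move=> sz_s s_uniq /all_nthP s_lt aE.
have valE (i : 'I_4) : paley13_map s i = nth 0 s i :> nat.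
  by rewrite inordK // s_lt // sz_s.
exists (paley13_map s); split=> [i j /(congr1 val)|i j] /=.
  by rewrite !valE => /eqP; rewrite nth_uniq ?sz_s // => /eqP/val_inj.
by rewrite /ord_adj !valE aE.
Qed.

Lemma claw_in_paley13 : claw ⊏ paley13.
Proof.
(* The leaves 1, 3, 9 are squares modulo 13, while their differences 2, 6, 8 are not; 0 is the
   centre. *)
by apply: (@induced_paley13 _ _ _ [:: 0; 1; 3; 9]) => //;
   case=> [[|[|[|[|i]]]] i_lt] // [[|[|[|[|j]]]] j_lt].
Qed.

Lemma diamond_in_paley13 : diamond ⊏ paley13.
Proof.
(* Among 1, 3, 0, 4 the only non-square difference is 3 - 1 = 2, which gives the missing edge. *)
by apply: (@induced_paley13 _ _ _ [:: 1; 3; 0; 4]) => //;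
   case=> [[|[|[|[|i]]]] i_lt] // [[|[|[|[|j]]]] j_lt].
Qed.

Local Notation edge9 := (nat_adj same_line).

(** The neighbours of a cell lie on its two lines, so among any three of them two share a line and
    are adjacent. The proof checks all quadruples by evaluation. *)
Lemma claw_notin_paley9 : ~ claw ⊏ paley9.
Proof.
have no_claw : all_below 9 (fun c => all_below 9 (fun x => all_below 9 (fun y =>
    all_below 9 (fun z => ~~ [&& edge9 c x, edge9 c y, edge9 c z, x != y, x != z,
      y != z, ~~ edge9 x y, ~~ edge9 x z & ~~ edge9 y z])))) by vm_compute.
case=> f [f_inj f_adj].
pose v i : 'I_4 := inord i.
have := all_belowP (all_belowP (all_belowP (all_belowP no_claw
  (f (v 0))) (f (v 1))) (f (v 2))) (f (v 3)).
have adjE i j : edge9 (f i) (f j) = claw_adj i j by exact: f_adj.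
have eqE i j : (f i == f j :> nat) = (i == j) by rewrite -(inj_eq f_inj).
by rewrite !adjE !eqE /claw_adj -!val_eqE /= !inordK.
Qed.

(** Two adjacent cells have a single common neighbour, the third cell of their line, whereas the
    diamond needs two. Again all quadruples are checked. *)
Lemma diamond_notin_paley9 : ~ diamond ⊏ paley9.
Proof.
have no_diamond : all_below 9 (fun x => all_below 9 (fun y => all_below 9 (fun z =>
    all_below 9 (fun t => ~~ [&& edge9 z t, edge9 x z, edge9 x t, edge9 y z,
      edge9 y t, x != y & ~~ edge9 x y])))) by vm_compute.
case=> f [f_inj f_adj].
pose v i : 'I_4 := inord i.
have := all_belowP (all_belowP (all_belowP (all_belowP no_diamond
  (f (v 0))) (f (v 1))) (f (v 2))) (f (v 3)).
have adjE i j : edge9 (f i) (f j) = diamond_adj i j by exact: f_adj.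
have eqE i j : (f i == f j :> nat) = (i == j) by rewrite -(inj_eq f_inj).
by rewrite !adjE !eqE /diamond_adj -!val_eqE /= !inordK.
Qed.

Theorem theorem4p8 :
  [/\ W_is claw 4, Wstar_is claw 4 & E_is claw 4] /\
  [/\ W_is diamond 4, Wstar_is diamond 4 & E_is diamond 4].
Proof.
split.
- apply: (indices_of_witnesses _ EA3_paley13 EA3_paley9 claw_in_paley13
    claw_notin_paley9); exact: card_ord.
- apply: (indices_of_witnesses _ EA3_paley13 EA3_paley9 diamond_in_paley13
    diamond_notin_paley9); exact: card_ord.
Qed.
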